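(* Let $(A,\mu)$ be a partially crossed topological $G-R$-bimodule. Suppose that $G$ is a discrete group and that $A$ and $R$ are compact. Then $H^{1}(G,(A,\mu))$ is compact.
   Context: All topological groups ($G$, $R$, $A$) are assumed Hausdorff (not necessarily abelian). A topological $G$-module is a topological group $A$ with a continuous left action of the topological group $G$ on $A$ by group automorphisms, $(g,a)\mapsto {}^{g}a$. Every topological group acts on itself by conjugation: ${}^{g}h=ghg^{-1}$. If several groups act on $A$, a word acts by successive actions, e.g. ${}^{grg^{-1}}a={}^{g}({}^{r}({}^{g^{-1}}a))$. A precrossed topological $R$-module is a pair $(A,\mu)$ where $A$ is a topological $R$-module and $\mu:A\to R$ is a continuous homomorphism with $\mu({}^{r}a)={}^{r}\mu(a)=r\mu(a)r^{-1}$ for all $r\in R$, $a\in A$. It is a partially crossed topological $R$-module if ${}^{\mu(a)}b={}^{a}b=aba^{-1}$ for all $b\in A$ and all $a\in A$ with $\mu(a)\in[R,R]$ (the commutator subgroup). A precrossed topological $G-R$-bimodule is a precrossed topological $R$-module $(A,\mu)$ such that (1) $G$ acts continuously (by automorphisms) on $R$ and on $A$; (2) $\mu$ is a $G$-homomorphism, i.e. $\mu({}^{g}a)={}^{g}\mu(a)$; (3) ${}^{({}^{g}r)}a={}^{grg^{-1}}a$ for all $g\in G$, $r\in R$, $a\in A$. It is a partially crossed topological $G-R$-bimodule if moreover $(A,\mu)$ is a partially crossed topological $R$-module. A crossed homomorphism is a map $\alpha:G\to A$ with $\alpha(gh)=\alpha(g)\,{}^{g}\alpha(h)$ for all $g,h\in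 G$. $Der_{c}(G,(A,\mu))$ is the set of pairs $(\alpha,r)$ with $\alpha:G\to A$ a continuous crossed homomorphism and $r\in R$ such that $\mu(\alpha(g))=r\,({}^{g}r)^{-1}$ for all $g\in G$. It carries the subspace topology from $\mathcal{C}_{k}(G,A)\times R$, where $\mathcal{C}_{k}(G,A)$ is the set of continuous maps $G\to A$ with the compact-open topology. $H^{0}(G,R)=\{r\in R: {}^{g}r=r\ \forall g\in G\}$. On $Der_{c}(G,(A,\mu))$ define $(\alpha,r)\sim(\beta,s)$ iff there is $a\in A$ with $\beta(g)=a^{-1}\alpha(g)\,{}^{g}a$ for all $g\in G$ and $s=\mu(a)^{-1}r$ mod $H^{0}(G,R)$ (i.e. $s\in\mu(a)^{-1}rH^{0}(G,R)$). This is an equivalence relation, and $H^{1}(G,(A,\mu))$ is the quotient set $Der_{c}(G,(A,\mu))/\sim$ with the quotient topology. *)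

(* Defs.v *)
From HB Require Import structures.
From mathcomp Require Import all_boot generic_quotient.
From mathcomp Require Import all_classical topology function_spaces.

Set Implicit Arguments.
Unset Strict Implicit.
Unset Printing Implicit Defensive.
Set Warnings "-redundant-canonical-projection".

Local Open Scope classical_set_scope.
Local Open Scope quotient_scope.
Local Open Scope group_scope.

HB.mixin Record isHausdorffTopGroup G & Topological G & Group G := {
  mulg_continuous : continuous (fun x : G * G => x.1 * x.2);
  invg_continuous : continuous (fun x : G => x^-1);
  topgroup_hausdorff : hausdorff_space G
}.

#[short(type="topGroupType")]
HB.structure Definition TopGroup :=
  {G of isHausdorffTopGroup G & Topological G & Group G}.

Definition discrete_space (T : topologicalType) :=
  @nbhs T T = @principal_filter T.

(* Bijectivity of each [act g] follows from
   [act1] and [actM]. *)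
Record topModule (G A : topGroupType) := TopModule {
  act :> G -> A -> A;
  act1 : forall a, act 1 a = a;
  actM : forall g h a, act (g * h) a = act g (act h a);
  act_morph : forall g a b, act g (a * b) = act g a * act g b;
  act_continuous : continuous (fun x : G * A => act x.1 x.2)
}.

Record precrossedModule (R A : topGroupType) := PrecrossedModule {
  actR : topModule R A;
  mu : A -> R;
  mu_continuous : continuous mu;
  mu_morph : forall a b, mu (a * b) = mu a * mu b;
  mu_actR : forall r a, mu (actR r a) = r * mu a * r^-1
}.

Definition is_subgroup (R : topGroupType) (H : set R) :=
  [/\ H 1, forall x y, H x -> H y -> H (x * y) & forall x, H x -> H x^-1].

(* The abstract commutator subgroup [R, R], without topological closure. *)
Definition commutator_subgroup (R : topGroupType) : set R :=
  smallest (@is_subgroup R) [set c | exists x y : R, c = [~ x, y]].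

Definition partially_crossed (R A : topGroupType)
    (M : precrossedModule R A) :=
  forall a, commutator_subgroup (mu M a) ->
    forall b, actR M (mu M a) b = a * b * a^-1.

Record precrossedBimodule (G R A : topGroupType) := PrecrossedBimodule {
  bimod_mod :> precrossedModule R A;
  actGR : topModule G R;
  actGA : topModule G A;
  mu_actG : forall g a, mu bimod_mod (actGA g a) = actGR g (mu bimod_mod a);
  actR_actG : forall g r a,
    actR bimod_mod (actGR g r) a = actGA g (actR bimod_mod r (actGA g^-1 a))
}.

Record partiallyCrossedBimodule (G R A : topGroupType) :=
  PartiallyCrossedBimodule {
    pcb_bimod :> precrossedBimodule G R A;
    pcb_partially_crossed : partially_crossed pcb_bimod
  }.

Definition crossed_hom (G A : topGroupType) (act : topModule G A)
    (alpha : G -> A) :=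
  forall g h, alpha (g * h) = alpha g * act g (alpha h).

Definition H0 (G R : topGroupType) (act : topModule G R) : set R :=
  [set r | forall g, act g r = r].

(* The compact-open topology on continuous maps, obtained as the subspace
   topology of the library's compact-open topology on all maps. *)
Definition Ck_set (X Y : topologicalType) : set {compact-open, X -> Y} :=
  [set f | continuous (f : X -> Y)].

Definition Ck (X Y : topologicalType) : Type := set_type (@Ck_set X Y).
HB.instance Definition _ (X Y : topologicalType) :=
  Topological.copy (Ck X Y) (set_type (@Ck_set X Y)).

Definition Ck_fun (X Y : topologicalType) (f : Ck X Y) : X -> Y := set_val f.
Coercion Ck_fun : Ck >-> Funclass.

Section Cohomology.
Context (G R A : topGroupType) (M : precrossedBimodule G R A).

Definition Der_set : set (Ck G A * R) :=
  [set x : Ck G A * R | crossed_hom (actGA M) x.1 /\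
    forall g, mu M (x.1 g) = x.2 * (actGR M g x.2)^-1].

Definition Der : Type := set_type Der_set.
HB.instance Definition _ := Topological.copy Der (set_type Der_set).

Definition der_hom (d : Der) : G -> A := (set_val d).1.
Definition der_elt (d : Der) : R := (set_val d).2.

Definition der_equiv (d e : Der) : Prop :=
  exists a : A,
    (forall g, der_hom e g = a^-1 * der_hom d g * actGA M g a) /\
    exists2 z, H0 (actGR M) z & der_elt e = (mu M a)^-1 * der_elt d * z.

Definition der_rel (d e : Der) : bool := `[< der_equiv d e >].

Lemma actG_inv (X : topGroupType) (m : topModule G X) g x :
  m g x^-1 = (m g x)^-1.
Proof.
have m1 : m g 1 = 1.
  by apply: (@mulgI _ (m g 1)); rewrite -act_morph !mulg1.
by apply: (@mulgI _ (m g x)); rewrite -act_morph !mulgV.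
Qed.

Lemma mu1 : mu M 1 = 1.
Proof. by apply: (@mulgI _ (mu M 1)); rewrite -mu_morph !mulg1. Qed.

Lemma muV a : mu M a^-1 = (mu M a)^-1.
Proof. by apply: (@mulgI _ (mu M a)); rewrite -mu_morph !mulgV mu1. Qed.

Lemma der_rel_refl : reflexive der_rel.
Proof.
move=> d; apply/asboolP; exists 1; split=> [g|].
  have -> : actGA M g 1 = 1.
    by apply: (@mulgI _ (actGA M g 1)); rewrite -act_morph !mulg1.
  by rewrite invg1 mul1g mulg1.
exists 1; last by rewrite mu1 invg1 mul1g mulg1.
by move=> g; apply: (@mulgI _ (actGR M g 1)); rewrite -act_morph !mulg1.
Qed.

Lemma der_equiv_sym d e : der_equiv d e -> der_equiv e d.
Proof.
move=> [a [ha [z hz he]]]; exists a^-1; split=> [g|].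
  by rewrite ha actG_inv invgK !mulgA mulgV mul1g mulgK.
exists z^-1; first by move=> g; rewrite actG_inv hz.
by rewrite he muV invgK !mulgA mulgV mul1g mulgK.
Qed.

Lemma der_rel_sym : symmetric der_rel.
Proof.
by move=> d e; apply/asboolP/asboolP; apply: der_equiv_sym.
Qed.

Lemma der_rel_trans : transitive der_rel.
Proof.
move=> e d f /asboolP[a [ha [z hz he]]] /asboolP[b [hb [w hw hf]]].
apply/asboolP; exists (a * b); split=> [g|].
  by rewrite hb ha act_morph invgM !mulgA.
exists (z * w); first by move=> g; rewrite act_morph hz hw.
by rewrite hf he mu_morph invgM !mulgA.
Qed.

Canonical der_equiv_rel := EquivRel der_rel
  der_rel_refl der_rel_sym der_rel_trans.

Definition H1 : Type := quotient_topology {eq_quot der_equiv_rel}.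
HB.instance Definition _ := Topological.on H1.

End Cohomology.

(* Main.v *)
Require Import Defs.
From mathcomp Require Import classical_sets topology.
From mathcomp Require Import all_boot.
From mathcomp Require Import boolp functions.

(** The space [H1 M] is a quotient of [Der M], so it is enough that [Der M] is
    compact.  Since [G] is discrete, every map [G -> A] is continuous and the
    compact-open topology on these maps is that of pointwise convergence,
    because compact subsets of [G] are finite ([pointwise_cvg_compact_open]
    uses this in the form of the near-covering property).  Hence [Der M] sits
    in the product [A ^ G * R], which is compact by Tychonoff, and it is closed
    there because its defining equations involve finitely many coordinates at a
    time, through continuous operations, in Hausdorff groups.

    The argument is run with ultrafilters.  Along an ultrafilter on [Der M] each
    value [alpha g] converges in [A] and the second component converges in [R];
    the equations pass to the limits, which therefore form a point of [Der M]
    ([Der_limit]), and the ultrafilter converges to this point ([cvg_Der]). *)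

Set Implicit Arguments.
Unset Strict Implicit.
Unset Printing Implicit Defensive.

Local Open Scope classical_set_scope.
Local Open Scope quotient_scope.
Local Open Scope group_scope.

(** Of [f @^-1` B] and its complement one lies in [F]; when [B] belongs to a
    proper filter finer than [f @ F], it cannot be the complement. *)
Lemma ultra_fmap (T U : Type) (f : T -> U) (F : set_system T) :
  UltraFilter F -> UltraFilter (f @ F).
Proof.
move=> FU; split; first exact: fmap_proper_filter.
move=> G GP FG; apply/seteqP; split=> // B GB.
have [//|FBC] := in_ultra_setVsetC (f @^-1` B) FU.
have GBC : G (~` B) by exact: FG.
by case: (filter_ex (filterI GB GBC)) => x [].
Qed.

Lemma ultra_compact_cvg (T : Type) (X : topologicalType) (f : T -> X)
    (F : set_system T) :
  compact [set: X] -> UltraFilter F -> exists x : X, f @ F --> x.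
Proof.
rewrite compact_ultra => Xco FU.
by have [|x [_ fx]] := Xco _ (ultra_fmap f FU); [exact: filterT|exists x].
Qed.

Section Discrete.
Context (G X : topologicalType) (G_discrete : @nbhs G G = @principal_filter G).

Lemma discrete_continuous (f : G -> X) : continuous f.
Proof.
by move=> x U /nbhs_singleton Ufx; rewrite G_discrete; apply/principal_filterP.
Qed.

(** The neighbourhood [[set x]] of [x] turns pointwise convergence at [x] into
    a local condition, which near-covering makes uniform over a compact set. *)
Lemma pointwise_cvg_compact_open (T : Type) (F : set_system T)
    (h : T -> G -> X) (f : G -> X) :
  Filter F -> (forall x, h^~ x @ F --> f x) ->
  {compact-open, h @ F --> f}.
Proof.
move=> FF hf; apply/compact_open_cvgP => K O /compact_near_coveringP Kco oO fO.
have : \near F, K `<=` [set x | O (h F x)].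
  apply: Kco => x Kx.
  exists ([set x], [set t | O (h t x)]) => /=; last by case=> _ t [/= -> ].
  split; first by rewrite G_discrete; exact/principal_filterP.
  by apply: hf; apply: open_nbhs_nbhs; split=> //; apply: fO; exists x.
by apply: filterS => t KO _ [x Kx <-]; exact: KO.
Qed.

End Discrete.

Section TopologicalGroupLimits.
Context (T : Type) (F : set_system T) (FF : Filter F) (X : topGroupType).

Lemma cvg_mulg (f g : T -> X) (a b : X) :
  f @ F --> a -> g @ F --> b -> (fun t => f t * g t) @ F --> a * b.
Proof.
move=> fa gb; apply: (continuous2_cvg FF _ fa gb).
exact: (mulg_continuous (a, b)).
Qed.

Lemma cvg_invg (f : T -> X) (a : X) :
  f @ F --> a -> (fun t => (f t)^-1) @ F --> a^-1.
Proof.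
by move=> fa; apply: continuous_cvg (fa); exact: invg_continuous.
Qed.

Lemma cvg_act (G : topGroupType) (m : topModule G X) g (f : T -> X) (a : X) :
  f @ F --> a -> (fun t => m g (f t)) @ F --> m g a.
Proof.
move=> fa; apply: (continuous2_cvg FF _ (cvg_cst g) fa).
exact: (@act_continuous _ _ m (g, a)).
Qed.

End TopologicalGroupLimits.

Lemma cvg_set_type (X : topologicalType) (S : set X) (F : set_system S)
    (x : S) :
  Filter F -> set_val @ F --> set_val x -> F --> x.
Proof.
move=> FF Fx U [_ [[V oV <-] Vx] /filterS]; apply.
by apply: Fx; exact: open_nbhs_nbhs.
Qed.

Section Der.
Context (G R A : topGroupType) (M : precrossedBimodule G R A).

(** The topology of [Der M] is initial for its two components, and on the first
    one pointwise convergence suffices because [G] is discrete. *)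
Lemma cvg_Der (G_discrete : discrete_space G) (F : set_system (Der M))
    (d : Der M) :
  Filter F -> (forall g, (fun e => der_hom e g) @ F --> der_hom d g) ->
  der_elt (M := M) @ F --> der_elt d -> F --> d.
Proof.
move=> FF Fhom Felt; apply: cvg_set_type.
have Fhom1 : (fun e : Der M => (set_val e).1) @ F --> (set_val d).1.
  by apply: cvg_set_type; exact: pointwise_cvg_compact_open.
have -> : set_val = (fun e : Der M => ((set_val e).1, (set_val e).2)).
  by apply/funext => e; exact: surjective_pairing.
by rewrite [set_val d]surjective_pairing; exact: cvg_pair Fhom1 Felt.
Qed.

(** Both sides of each defining equation of [Der M] converge along [F], and
    limits in a Hausdorff group are unique, so the equations hold for [alpha]
    and [r].  Continuity of [alpha], which pointwise limits do not preserve in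
    general, comes from the discreteness of [G]. *)
Lemma Der_limit (G_discrete : discrete_space G) (F : set_system (Der M))
    (alpha : G -> A) (r : R) :
  ProperFilter F -> (forall g, (fun e => der_hom e g) @ F --> alpha g) ->
  der_elt (M := M) @ F --> r ->
  exists d : Der M, (forall g, der_hom d g = alpha g) /\ der_elt d = r.
Proof.
move=> FF Falpha Fr.
have alphaC : Ck_set (alpha : {compact-open, G -> A}).
  exact: discrete_continuous.
pose a : Ck G A := exist (fun f => f \in @Ck_set G A) _ (mem_set alphaC).
have aE : Ck_fun a = alpha by [].
have ar_Der : Der_set M (a, r).
  split=> [g h|g] /=; rewrite aE.
  - apply: (cvg_unique (@topgroup_hausdorff A)) (Falpha (g * h)) _.
    rewrite (_ : (fun e => _) = fun e : Der M =>
      der_hom e g * actGA M g (der_hom e h)).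
      by apply: cvg_mulg => //; exact: cvg_act.
    by apply/funext => e; case: (set_valP e) => + _; exact.
  - have Fmu : (fun e => mu M (der_hom e g)) @ F --> mu M (alpha g).
      by apply: continuous_cvg (Falpha g); exact: mu_continuous.
    apply: (cvg_unique (@topgroup_hausdorff R)) Fmu _.
    rewrite (_ : (fun e => _) = fun e : Der M =>
      der_elt e * (actGR M g (der_elt e))^-1).
      by apply: cvg_mulg => //; apply: cvg_invg; exact: cvg_act.
    by apply/funext => e; case: (set_valP e) => _; exact.
by exists (exist (fun d => d \in Der_set M) _ (mem_set ar_Der)).
Qed.

Lemma Der_compact : discrete_space G -> compact [set: A] -> compact [set: R] ->
  compact [set: Der M].
Proof.
move=> Gd Aco Rco; rewrite compact_ultra => F FU _.
have /choice[alpha Falpha] g := ultra_compact_cvg (fun d => der_hom d g) Aco FU.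
have [r Fr] := ultra_compact_cvg (der_elt (M := M)) Rco FU.
have [d [dalpha dr]] := Der_limit Gd _ Falpha Fr.
exists d; split=> //; apply: cvg_Der => // [g|]; last by rewrite dr.
by rewrite dalpha.
Qed.

End Der.

Theorem theorem3p8 (G R A : topGroupType) (M : partiallyCrossedBimodule G R A)
    (G_discrete : discrete_space G)
    (A_compact : compact [set: A]%classic)
    (R_compact : compact [set: R]%classic) :
  compact [set: H1 M]%classic.
Proof.
have Dco : compact [set: Der M] by exact: Der_compact.
have -> : [set: H1 M] = \pi_(H1 M) @` [set: Der M].
  by apply/seteqP; split=> // x _; exists (repr x) => //; exact: reprK.
apply: continuous_compact Dco; apply: continuous_subspaceT.
exact: pi_continuous.
Qed.
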